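(* Let $f,g:\mathbb{R}^n\to\mathbb{R}\cup\{+\infty\}$ be closed convex proper functions and let $h:\mathbb{R}^n\to\mathbb{R}$ be convex and $L$-smooth with $L>0$, such that there exist $x^\star,u^\star\in\mathbb{R}^n$ with $0\in\partial f(x^\star)+\nabla h(x^\star)+u^\star$ and $0\in\partial g^*(u^\star)-x^\star$. Let $\alpha=\frac1L$, let $x^0,u^0\in\mathbb{R}^n$, and let $\{(x^k,u^k)\}_{k\ge 0}$ be generated by $$x^{k+1}=\mathrm{prox}_{\alpha f}\big(x^k-\alpha(u^k+\nabla h(x^k))\big),\qquad u^{k+1}=\mathrm{prox}_{\alpha^{-1}g^*}\Big(u^k+\tfrac1\alpha\big(2x^{k+1}-x^k+\alpha\nabla h(x^k)-\alpha\nabla h(x^{k+1})\big)\Big),\qquad k=0,1,2,\dots$$ For each integer $K\ge1$ put $\bar x^K=\frac1K\sum_{k=1}^K x^k$ and $\bar u^K=\frac1K\sum_{k=1}^K u^k$. Then for all integers $K\ge1$, all $x\in\mathrm{dom}\, f$ and all $u\in\mathrm{dom}\, g^*$, $$\mathcal{L}(\bar x^K,u)-\mathcal{L}(x,\bar u^K)\le\frac{1}{\alpha(K+1)}\left(\|x^0-x\|^2+\alpha^2\|u^0-u\|^2\right).$$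
   Context: $\langle\cdot,\cdot\rangle$ and $\|\cdot\|$ are the standard inner product and Euclidean norm on $\mathbb{R}^n$. $h$ is $L$-smooth if it is differentiable with $L$-Lipschitz gradient. $g^*(y)=\sup_x\{\langle y,x\rangle-g(x)\}$ is the Fenchel conjugate, $\partial$ the convex subdifferential, and $\mathrm{prox}_\varphi(x)=\arg\min_{y}\{\varphi(y)+\frac12\|y-x\|^2\}$. The Lagrangian is $\mathcal{L}(x,u)=f(x)+h(x)+\langle u,x\rangle-g^*(u)$. The iteration is the swapped Davis--Yin splitting algorithm (variant DYS-$fg$) for minimizing $f+g+h$. *)

(* Defs.v *)
From HB Require Import structures.
From mathcomp Require Import all_boot all_order all_algebra.
From mathcomp Require Import all_classical all_reals all_analysis.
Set Implicit Arguments.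
Unset Strict Implicit.
Unset Printing Implicit Defensive.
Import Order.TTheory GRing.Theory Num.Theory.
Import numFieldNormedType.Exports.
Local Open Scope classical_set_scope.
Local Open Scope ring_scope.

Definition dot (R : realType) (n : nat) (x y : 'rV[R]_n) : R :=
  \sum_(i < n) x 0 i * y 0 i.

(* The library norm `|x| on 'rV[R]_n is the sup norm, hence a separate name. *)
Definition enorm (R : realType) (n : nat) (x : 'rV[R]_n) : R :=
  Num.sqrt (dot x x).

Definition edom (R : realType) (n : nat) (f : 'rV[R]_n -> \bar R) :
    set 'rV[R]_n :=
  [set x | (f x < +oo)%E].

Definition epigraph (R : realType) (n : nat) (f : 'rV[R]_n -> \bar R) :
    set ('rV[R]_n * R) :=
  [set p | (f p.1 <= p.2%:E)%E].

Definition proper_fun (R : realType) (n : nat) (f : 'rV[R]_n -> \bar R) : Prop :=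
  (forall x, (-oo < f x)%E) /\ edom f !=set0.

(* The library's [convex_function] is for real-valued functions only; t ranges
   over the open interval, so that no product 0 * +oo occurs. *)
Definition econvex (R : realType) (n : nat) (f : 'rV[R]_n -> \bar R) : Prop :=
  forall (x y : 'rV[R]_n) (t : R), 0 < t < 1 ->
    (f (t *: x + (1 - t) *: y)%R <= t%:E * f x + (1 - t)%:E * f y)%E.

Definition closed_convex_proper (R : realType) (n : nat)
    (f : 'rV[R]_n -> \bar R) : Prop :=
  [/\ closed (epigraph f), econvex f & proper_fun f].

Definition grad (R : realType) (n : nat) (h : 'rV[R]_n -> R) (x : 'rV[R]_n) :
    'rV[R]_n :=
  \row_(i < n) 'D_(delta_mx 0 i) h x.

Definition smooth (R : realType) (n : nat) (L : R) (h : 'rV[R]_n -> R) : Prop :=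
  (forall x, differentiable h x) /\
  (forall x y, enorm (grad h x - grad h y) <= L * enorm (x - y)).

Definition fenchel (R : realType) (n : nat) (g : 'rV[R]_n -> \bar R)
    (y : 'rV[R]_n) : \bar R :=
  ereal_sup [set ((dot y x)%:E - g x)%E | x in [set: 'rV[R]_n]].

Definition subdiff (R : realType) (n : nat) (f : 'rV[R]_n -> \bar R)
    (x : 'rV[R]_n) : set 'rV[R]_n :=
  [set v | forall y, (f x + (dot v (y - x)%R)%:E <= f y)%E].

Definition argmin (R : realType) (n : nat) (f : 'rV[R]_n -> \bar R) :
    set 'rV[R]_n :=
  [set p | forall y, (f p <= f y)%E].

(* prox as the set of minimizers, which is a singleton when phi is closed,
   convex and proper. *)
Definition prox (R : realType) (n : nat) (phi : 'rV[R]_n -> \bar R)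
    (x : 'rV[R]_n) : set 'rV[R]_n :=
  argmin (fun y => phi y + (2^-1 * enorm (y - x) ^+ 2)%:E)%E.

Definition lagrangian (R : realType) (n : nat) (f g : 'rV[R]_n -> \bar R)
    (h : 'rV[R]_n -> R) (x u : 'rV[R]_n) : \bar R :=
  (f x + (h x)%:E + (dot u x)%:E - fenchel g u)%E.

Definition ergodic_mean (R : realType) (n : nat) (x : nat -> 'rV[R]_n)
    (K : nat) : 'rV[R]_n :=
  K%:R^-1 *: \sum_(1 <= k < K.+1) x k.

(* Main.v *)
Require Import Defs.
From HB Require Import structures.
From mathcomp Require Import all_boot all_order all_algebra.
From mathcomp Require Import all_classical all_reals all_analysis.
From mathcomp Require Import ring lra.
Set Implicit Arguments.
Unset Strict Implicit.
Unset Printing Implicit Defensive.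
Import Order.TTheory GRing.Theory Num.Theory.
Import numFieldNormedType.Exports.
Local Open Scope classical_set_scope.
Local Open Scope ring_scope.

(** Write [a] for the step size, [G z] for the gradient of [h] at [z], and put
<<
    D k = a (G (x k) - G y),   W k = (x k - y) - a (u k - v) - D k,
    S = x 0 - y - D 0,         lam = 2 / (K + 1).
>>
    The optimality conditions of the two proximal steps bound the primal-dual
    gap at [(x (k+1), u (k+1))], tested against [(y, v)], by
<<
    a gap(k+1) <= <W k - W (k+1), W (k+1) + D (k+1)> - a breg(k+1),
>>
    where [breg(k)] is the Bregman distance [h y - h (x k) - <G (x k), y - x k>]
    ([primal_dual_gap_bound]).  Cocoercivity gives [a breg(k) >= |D k|^2 / 2],
    and completing the square shows that [|W k|^2 / 2] decreases by [a gap(k+1)]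
    at least.  Summed up, this yields a rate with [K] in the denominator.

    The denominator [K + 1] comes from two refinements.  The squares
    [|W k - W (k+1) - D (k+1)|^2] left over by the completion turn [K] into
    [K + 1] when [h] is affine, but a suitable [h] can make them vanish;
    such an [h] is then steep at the iterates, which costs something in the
    inequalities between [x 0], [x k] and [y].  So a fraction [lam] of the
    cocoercivity inequality for the pair [(x k, y)] is replaced by the sum of
    those for [(x k, x 0)] and [(x 0, y)]; this adds [lam <D k - D 0, S>] to the
    lower bound on [a breg(k)] ([bregman_lower_bound]).  With the new term, the
    quantity that telescopes is [|W k - lam S|^2 / 2], up to a constant loss per
    step ([telescoping_bound]).  What remains at the end is a quadratic
    inequality in the three vectors [S], [D 0], [a (u 0 - v)], and
    [lam = 2 / (K + 1)] is the value for which it holds with the factor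
    [K / (K + 1)] ([initial_potential_bound]).  Jensen's inequality finally
    passes from the average of the gaps to the gap of the averages. *)

(** * Inner product algebra *)

(** Reduces an inequality to the identity that exhibits [b - a] as a sum of terms
    already known to be nonnegative. *)
Lemma le_of_slack (R : numDomainType) (s a b : R) :
  0 <= s -> s = b - a -> a <= b.
Proof. by move=> s0 sE; rewrite -subr_ge0 -sE. Qed.

Section Dot.
Variables (R : realType) (n : nat).
Implicit Types (x y z : 'rV[R]_n) (a : R).

Lemma dotC x y : dot x y = dot y x.
Proof. by apply: eq_bigr => i _; rewrite mulrC. Qed.

Lemma dotDl x y z : dot (x + y) z = dot x z + dot y z.
Proof. by rewrite /dot -big_split; apply: eq_bigr => i _; rewrite mxE mulrDl. Qed.

Lemma dotZl a x y : dot (a *: x) y = a * dot x y.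
Proof. by rewrite /dot mulr_sumr; apply: eq_bigr => i _; rewrite mxE mulrA. Qed.

Lemma dotNl x y : dot (- x) y = - dot x y.
Proof. by rewrite -scaleN1r dotZl mulN1r. Qed.

Lemma dotDr x y z : dot z (x + y) = dot z x + dot z y.
Proof. by rewrite dotC dotDl !(dotC z). Qed.

Lemma dotZr a x y : dot y (a *: x) = a * dot y x.
Proof. by rewrite dotC dotZl (dotC y). Qed.

Lemma dotNr x y : dot y (- x) = - dot y x.
Proof. by rewrite dotC dotNl (dotC y). Qed.

Lemma dot_ge0 x : 0 <= dot x x.
Proof. by apply: sumr_ge0 => i _; rewrite -expr2 sqr_ge0. Qed.

Lemma enorm_sq x : enorm x ^+ 2 = dot x x.
Proof. by rewrite sqr_sqrtr // dot_ge0. Qed.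

Lemma dot_sumr (I : Type) (s : seq I) (F : I -> 'rV[R]_n) z :
  dot z (\sum_(i <- s) F i) = \sum_(i <- s) dot z (F i).
Proof.
elim/big_ind2 : _ => [|u p v q <- <-|//]; last exact: dotDr.
by rewrite -(scale0r z) dotZr mul0r.
Qed.

Definition dotE := (dotDl, dotDr, dotNl, dotNr, dotZl, dotZr).

End Dot.

(** Expands inner products and orients each mixed product in a single way, so
    that [field] and [lra] can treat them as independent variables. *)
Ltac dot_normalize :=
  rewrite ?enorm_sq ?dotE;
  repeat match goal with |- context [dot ?a ?b] =>
    match goal with |- context [dot b a] =>
      tryif constr_eq a b then fail else rewrite (dotC b a)
    end
  end.

(** * Smooth convex functions *)

Lemma convex_function_le (R : realType) (n : nat) (h : 'rV[R]_n -> R) :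
  convex_function [set: 'rV[R]_n] h ->
  forall x y (t : R), 0 <= t -> t <= 1 ->
  h (t *: x + (1 - t) *: y) <= t * h x + (1 - t) * h y.
Proof.
by move=> hc x y t t0 t1; apply: (hc (Itv01 t0 t1) x y); rewrite in_setE.
Qed.

Section Smooth.
Variables (R : realType) (n : nat) (h : 'rV[R]_n -> R) (L : R).
Hypothesis h_smooth : smooth L h.
Hypothesis L_gt0 : 0 < L.
Implicit Types x y d : 'rV[R]_n.

Lemma derive_dot_grad x d : 'D_d h x = dot (grad h x) d.
Proof.
have [dh _] := h_smooth.
rewrite deriveE // [in LHS](row_sum_delta d) linear_sum /dot.
by apply: eq_bigr => i _; rewrite linearZ /= mxE deriveE // mulrC.
Qed.

Lemma is_derive_line x d (t : R) :
  is_derive t 1 (fun s : R => h (x + s *: d)) (dot (grad h (x + t *: d)) d).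
Proof.
have [dh _] := h_smooth.
have E : (fun s : R => s^-1 *: (((fun s : R => h (x + s *: d)) \o shift t) (s *: 1)
            - h (x + t *: d))) =
         (fun s : R => s^-1 *: ((h \o shift (x + t *: d)) (s *: d)
            - h (x + t *: d))).
  apply/funext => s /=; congr (_ *: (h _ - _)).
  by rewrite [_ *: 1]mulr1 scalerDl addrCA.
have /diff_derivable dv := dh (x + t *: d).
apply: DeriveDef; rewrite /derivable /derive E; first exact: dv.
exact: derive_dot_grad.
Qed.

(** The descent lemma.  After subtracting the claimed quadratic upper bound along
    the segment from [x] to [y], the derivative is nonpositive on the open
    segment by Lipschitz continuity of the gradient. *)
Lemma smooth_upper_bound x y :
  h y <= h x + dot (grad h x) (y - x) + L / 2 * dot (y - x) (y - x).
Proof.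
set d := y - x; set G := grad h x.
pose psi := fun t : R => h (x + t *: d) - (t * dot G d + L / 2 * dot d d * t ^+ 2).
pose dpsi := fun t : R => dot (grad h (x + t *: d)) d - (dot G d + L * dot d d * t).
have dE (t : R) : is_derive t 1 psi (dpsi t).
  have dl := is_derive_line x d t.
  rewrite /psi; apply: is_derive_eq.
  rewrite /dpsi /GRing.scale /= /GRing.scale /=; lra.
have [|c] := @MVT R psi dpsi 0 1 ltr01 (fun t _ => dE t).
  apply: derivable_within_continuous => t _.
  by have [] := dE t.
rewrite in_itv /= => /andP[c0 c1].
rewrite subr0 mulr1 /psi scale1r scale0r addr0 /d [x + _]addrC subrK -/d.
suff : dpsi c <= 0 by lra.
rewrite /dpsi -/G; clear psi dpsi dE; clearbody d.
(* Young's inequality with weight [L * c] replaces Cauchy-Schwarz. *)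
have [_ /(_ (x + c *: d) x) gL] := h_smooth.
set H := grad h _ in gL *; move: gL; rewrite -/G addrAC subrr add0r.
clearbody G H => gL.
have {}gL : dot (H - G) (H - G) <= (L * c) ^+ 2 * dot d d.
  rewrite -!enorm_sq -exprMn.
  have -> : L * c * enorm d = L * enorm (c *: d).
    rewrite -mulrA; congr (_ * _); apply/eqP.
    rewrite -(@eqrXn2 _ 2) ?mulr_ge0 ?sqrtr_ge0 ?ltW //.
    by rewrite exprMn !enorm_sq dotZl dotZr mulrA.
  by rewrite lerXn2r // ?nnegrE ?sqrtr_ge0 // mulr_ge0 ?sqrtr_ge0 // ltW.
have Lc0 : 0 < L * c by rewrite mulr_gt0.
have := dot_ge0 (H - G - (L * c) *: d).
move: gL; dot_normalize => gL sq.
rewrite -(pmulr_rle0 _ Lc0); lra.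
Qed.

Lemma convex_lower_bound x y : convex_function [set: 'rV[R]_n] h ->
  h x + dot (grad h x) (y - x) <= h y.
Proof.
move=> hc; set d := y - x.
have := is_derive_line x d 0; rewrite scale0r addr0 => -[dv <-].
rewrite -lerBrDl /derive /=.
apply: (cvgr_to_le (cvg_dnbhs_at_right dv)).
near=> t.
have t0 : 0 < t by near: t; exact: nbhs_right_gt.
have t1 : t < 1 by near: t; exact: nbhs_right_lt.
have := convex_function_le hc y x (ltW t0) (ltW t1).
rewrite /= scale0r !addr0 [t *: 1]mulr1.
have -> : t *: y + (1 - t) *: x = x + t *: d.
  by rewrite /d scalerBl scalerBr scale1r addrCA.
move=> hle; rewrite /GRing.scale /= mulrC ler_pdivrMr //; lra.
Unshelve. all: by end_near. Qed.

(** Cocoercivity, in its function-value form: sandwich the value of [h] one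
    gradient step away from [y] between the tangent at [x] and the quadratic
    upper bound at [y]. *)
Lemma smooth_convex_lower_bound x y : convex_function [set: 'rV[R]_n] h ->
  h x + dot (grad h x) (y - x) +
    (2 * L)^-1 * dot (grad h y - grad h x) (grad h y - grad h x) <= h y.
Proof.
move=> hc; set Gx := grad h x; set Gy := grad h y.
(* The gradient step from [y] for [h - <Gx, .>], which is minimal at [x]. *)
have := convex_lower_bound x (y - L^-1 *: (Gy - Gx)) hc.
have := smooth_upper_bound y (y - L^-1 *: (Gy - Gx)).
rewrite -/Gx -/Gy -subr_ge0 => up; rewrite -subr_ge0 => low.
clearbody Gx Gy.
apply: (le_of_slack (addr_ge0 up low)).
by dot_normalize; field; rewrite gt_eqF.
Qed.

(** The weight [1 - lam] is put on the cocoercivity inequality between [x] and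
    [y], the weight [lam] on the path from [x] to [y] through [x0].  The second
    one alone gives [|D x|^2 / 2 + <D x - D x0, x0 - y - D x0>]. *)
Lemma bregman_lower_bound (x0 y x : 'rV[R]_n) (a lam : R) :
  convex_function [set: 'rV[R]_n] h ->
  a = L^-1 -> 0 <= lam <= 1 ->
  let D z := a *: (grad h z - grad h y) in
  2^-1 * dot (D x) (D x) + lam * dot (D x - D x0) (x0 - y - D x0)
    <= a * (h y - h x - dot (grad h x) (y - x)).
Proof.
move=> hc aE /andP[l0 l1]; cbv zeta.
have a0 : 0 < a by rewrite aE invr_gt0.
have := smooth_convex_lower_bound x y hc.
have := smooth_convex_lower_bound x x0 hc.
have := smooth_convex_lower_bound x0 y hc.
rewrite invfM -aE.
move: (grad h x) (grad h y) (grad h x0) (h x) (h y) (h x0) => G Gy G0 hx hy h0.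
clear aE.
rewrite -subr_ge0 => I3; rewrite -subr_ge0 => I2; rewrite -subr_ge0 => I1.
have la0 : 0 <= lam * a by rewrite mulr_ge0 // ltW.
have la1 : 0 <= (1 - lam) * a by rewrite mulr_ge0 ?subr_ge0 // ltW.
apply: (le_of_slack (addr_ge0 (mulr_ge0 la1 I1) (mulr_ge0 la0 (addr_ge0 I2 I3)))).
by dot_normalize; field.
Qed.

End Smooth.

(** * Extended-valued convex functions and proximal points *)

Section Convex.
Variables (R : realType) (n : nat).
Implicit Types (phi g : 'rV[R]_n -> \bar R).

Lemma econvex_le phi (x y : 'rV[R]_n) (a b t : R) : econvex phi ->
  (phi x <= a%:E)%E -> (phi y <= b%:E)%E -> 0 < t < 1 ->
  (phi (t *: x + (1 - t) *: y)%R <= (t * a + (1 - t) * b)%:E)%E.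
Proof.
move=> cphi xa yb t01; apply: le_trans (cphi x y t t01) _.
have /andP[t0 t1] := t01.
rewrite [leRHS]EFinD !EFinM.
by rewrite leeD // lee_wpmul2l // lee_fin ltW // subr_gt0.
Qed.

(** Jensen's inequality, by induction: the mean of [K + 1] points is a convex
    combination of the mean of the first [K] and the last one. *)
Lemma econvex_mean phi (x : nat -> 'rV[R]_n) (r : nat -> R) : econvex phi ->
  (forall k, (phi (x k.+1) <= (r k.+1)%:E)%E) ->
  forall K, (0 < K)%N ->
  (phi (ergodic_mean x K) <= (K%:R^-1 * \sum_(1 <= k < K.+1) r k)%:E)%E.
Proof.
move=> cphi xr; case=> // K _; elim: K => [|K IH].
  by rewrite /ergodic_mean invr1 scale1r mul1r !big_nat1.
pose t : R := K.+1%:R / K.+2%:R.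
have K1 : K.+1%:R != 0 :> R by rewrite pnatr_eq0.
have K2 : K.+2%:R != 0 :> R by rewrite pnatr_eq0.
have t01 : 0 < t < 1.
  by rewrite divr_gt0 ?ltr0n //= /t ltr_pdivrMr ?ltr0n // mul1r ltr_nat ltnSn.
have tE : 1 - t = K.+2%:R^-1.
  apply: (mulIf K2); rewrite mulrBl mul1r mulfVK // mulVf //.
  by rewrite -natrB // subSnn.
have tKE : t * K.+1%:R^-1 = K.+2%:R^-1 by rewrite /t mulrAC divff // mul1r.
have := econvex_le cphi IH (xr K.+1) t01.
rewrite tE mulrA tKE -mulrDr -big_nat_recr //=.
by rewrite /ergodic_mean scalerA tKE -scalerDr -big_nat_recr.
Qed.

Lemma fenchel_gtNy g v : edom g !=set0 -> (-oo < fenchel g v)%E.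
Proof.
move=> [x gx]; apply: lt_le_trans (ereal_sup_ubound _); last by exists x.
rewrite /edom /= in gx.
by move: gx; case: (g x) => //= r _; rewrite ltNyr.
Qed.

Lemma fenchel_econvex g : (forall x, (-oo < g x)%E) -> econvex (fenchel g).
Proof.
move=> gNy v w t /andP[t0 t1].
apply: ge_ereal_sup => _ [x _ <-].
have t1' : 0 < 1 - t by rewrite subr_gt0.
have ub z : ((dot z x)%:E - g x <= fenchel g z)%E.
  by apply: ereal_sup_ubound; exists x.
move: (gNy x) (ub v) (ub w); case gE : (g x) => [r| |] // _ ubv ubw.
  apply: le_trans (leeD (lee_wpmul2l _ ubv) (lee_wpmul2l _ ubw)); last 2 first.
  - by rewrite lee_fin ltW.
  - by rewrite lee_fin ltW.
  rewrite -!EFinB -!EFinM -EFinD lee_fin !dotE; lra.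
by rewrite leNye.
Qed.

(** The optimality condition of a proximal point: testing minimality along the
    segment from [p] to [y] and letting the step go to 0 removes the quadratic
    term. *)
Lemma prox_subgradient phi (c : R) (q p : 'rV[R]_n) : 0 < c ->
  econvex phi -> proper_fun phi -> prox (fun y => c%:E * phi y)%E q p ->
  phi p \is a fin_num /\
  forall (y : 'rV[R]_n) (s : R), phi y = s%:E ->
    dot (q - p) (y - p) <= c * (s - fine (phi p)).
Proof.
move=> c0 cphi [phiNy [z phiz]] pmin.
have fp : phi p \is a fin_num.
  have := pmin z; rewrite /edom /= in phiz.
  move: (phiNy z) (phiNy p) phiz; case: (phi z) => [s| |] //.
  case: (phi p) => [r| |] // _ _ _.
  by rewrite gt0_muley ?lte_fin // addye // leye_eq.
split=> // y s ys.
pose r := fine (phi p); have pr : phi p = r%:E by rewrite fineK.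
rewrite -/r.
have test t : 0 < t < 1 -> 0 <= c * (s - r) - dot (q - p) (y - p)
    + t * (2^-1 * dot (y - p) (y - p)).
  move=> t01; have /andP[t0 t1] := t01.
  have cvx : (phi (t *: y + (1 - t) *: p)%R <= (t * s + (1 - t) * r)%:E)%E.
    by apply: econvex_le; rewrite ?ys ?pr.
  have := pmin (t *: y + (1 - t) *: p).
  move: cvx (phiNy (t *: y + (1 - t) *: p)).
  case: (phi _) => [w| |] //; rewrite lee_fin => wle _.
  rewrite pr -!EFinM -!EFinD lee_fin.
  rewrite -(pmulr_rge0 _ t0).
  have : c * w <= c * (t * s + (1 - t) * r) by rewrite ler_pM2l.
  have -> : t *: y + (1 - t) *: p - q = (p - q) + t *: (y - p).
    by apply/rowP => i; rewrite !mxE; ring.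
  have -> : q - p = - (p - q) by rewrite opprB.
  move: (p - q) (y - p) => e d.
  by dot_normalize; lra.
set A := _ - dot _ _ in test.
suff : 0 <= A by rewrite subr_ge0.
have B0 : 0 <= 2^-1 * dot (y - p) (y - p) by rewrite mulr_ge0 ?dot_ge0.
set B := 2^-1 * _ in test B0.
rewrite leNgt; apply/negP => A0.
have BA : 0 < B - A by lra.
(* A step small enough for the linear term [A < 0] to dominate. *)
have := test (- A / (2 * (B - A))).
have -> : 0 < - A / (2 * (B - A)) < 1.
  rewrite divr_gt0 ?oppr_gt0 ?mulr_gt0 //= ltr_pdivrMr ?mulr_gt0 //; lra.
move=> /(_ isT); rewrite -(pmulr_rge0 _ BA).
have -> : (B - A) * (A + - A / (2 * (B - A)) * B) = (B - A) * A - A * B / 2.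
  by field; rewrite gt_eqF.
nra.
Qed.

End Convex.

(** * One iteration and its potential *)

Lemma sum_le_telescope (R : numDomainType) (a c : R) (G V : nat -> R) :
  (forall k, a * G k.+1 <= V k - V k.+1 + c) ->
  forall m, a * \sum_(1 <= k < m.+1) G k <= V 0%N - V m + m%:R * c.
Proof.
move=> step; elim=> [|m IH]; first by rewrite big_geq // mulr0 mul0r addr0 subrr.
rewrite big_nat_recr //= mulrDr; apply: le_trans (lerD IH (step m)) _.
by rewrite -natr1 mulrDl mul1r addrACA subrKA.
Qed.

Section Step.
Variables (R : realType) (n : nat).
Implicit Types (x y u v G W D S : 'rV[R]_n).

(** The slack is [|W - W' - D - lam S|^2 / 2]. *)
Lemma telescoping_bound W W' D D0 S (lam : R) :
  dot (W - W') (W' + D) - (2^-1 * dot D D + lam * dot (D - D0) S) <=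
  2^-1 * dot (W - lam *: S) (W - lam *: S)
  - 2^-1 * dot (W' - lam *: S) (W' - lam *: S)
  + (2^-1 * lam ^+ 2 * dot S S + lam * dot D0 S).
Proof.
have half_ge0 : 0 <= 2^-1 :> R by lra.
apply: (le_of_slack (mulr_ge0 half_ge0 (dot_ge0 (W - W' - D - lam *: S)))).
by dot_normalize; field.
Qed.

(** The left-hand sides of the two hypotheses are those of the optimality
    conditions of the two proximal steps.  In the weighted sum of these, the
    bilinear terms of the Lagrangian and the corrections of the dual step
    combine into a single inner product. *)
Lemma primal_dual_gap_bound x x' u u' y v G G' Gy (a fx fy gu gv hx hy : R) :
  0 < a ->
  dot (x - a *: (u + G) - x') (y - x') <= a * (fy - fx) ->
  dot (u + a^-1 *: (2 *: x' - x + a *: G - a *: G') - u') (v - u')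
    <= a^-1 * (gv - gu) ->
  let W z w H := z - y - a *: (w - v) - a *: (H - Gy) in
  a * (fx + hx + dot v x' - gv - (fy + hy + dot u' y - gu)) <=
  dot (W x u G - W x' u' G') (W x' u' G' + a *: (G' - Gy))
  - a * (hy - hx - dot G' (y - x')).
Proof.
move=> a0; rewrite -subr_ge0 => If; rewrite -subr_ge0 => Ig; cbv zeta.
have a2 : 0 <= a ^+ 2 by rewrite exprn_ge0 // ltW.
apply: (le_of_slack (addr_ge0 If (mulr_ge0 a2 Ig))).
by dot_normalize; field; rewrite gt_eqF.
Qed.

(** The potential at the start together with the loss of [K] steps.  The slack
    is [(K - 1) / (2 (K + 1)) |S + U|^2 + K / (K + 1) |D|^2]: the choice of [lam]
    makes the form in [S] and [U] a perfect square and cancels the product of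
    [D] and [S]. *)
Lemma initial_potential_bound (S D U : 'rV[R]_n) (K : nat) : (0 < K)%N ->
  let lam : R := 2 / (K%:R + 1) in
  2^-1 * dot (S - U - lam *: S) (S - U - lam *: S)
   + K%:R * (2^-1 * lam ^+ 2 * dot S S + lam * dot D S)
  <= K%:R / (K%:R + 1) * (dot (S + D) (S + D) + dot U U).
Proof.
move=> K0; cbv zeta.
have : 1 <= K%:R :> R by rewrite ler1n.
move: (K%:R) => k k1.
have kp : k + 1 != 0 by rewrite gt_eqF; lra.
have c1 : 0 <= (k - 1) / (2 * (k + 1)) by rewrite divr_ge0; lra.
have c2 : 0 <= k / (k + 1) by rewrite divr_ge0; lra.
apply: (le_of_slack (addr_ge0 (mulr_ge0 c1 (dot_ge0 (S + U)))
  (mulr_ge0 c2 (dot_ge0 D)))).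
by dot_normalize; field.
Qed.

End Step.

(** * The ergodic rate *)

Theorem theorem4p5 (R : realType) (n : nat)
  (f g : 'rV[R]_n -> \bar R) (h : 'rV[R]_n -> R) (L alpha : R)
  (f_ccp : closed_convex_proper f) (g_ccp : closed_convex_proper g)
  (h_convex : convex_function [set: 'rV[R]_n] h)
  (L_gt0 : 0 < L) (h_smooth : smooth L h)
  (saddle : exists xstar ustar : 'rV[R]_n,
      [set p + grad h xstar + ustar | p in subdiff f xstar] 0 /\
      [set q - xstar | q in subdiff (fenchel g) ustar] 0)
  (alphaE : alpha = 1 / L)
  (x u : nat -> 'rV[R]_n)
  (x_step : forall k : nat,
      prox (fun y => alpha%:E * f y)%E
           (x k - alpha *: (u k + grad h (x k))) (x k.+1))
  (u_step : forall k : nat,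
      prox (fun v => alpha^-1%:E * fenchel g v)%E
           (u k + alpha^-1 *: (2 *: x k.+1 - x k + alpha *: grad h (x k)
                               - alpha *: grad h (x k.+1)))
           (u k.+1)) :
  forall (K : nat), (1 <= K)%N ->
  forall (y v : 'rV[R]_n), edom f y -> edom (fenchel g) v ->
    (lagrangian f g h (ergodic_mean x K) v
       - lagrangian f g h y (ergodic_mean u K)
     <= (1 / (alpha * (K%:R + 1))
          * (enorm (x 0%N - y) ^+ 2 + alpha ^+ 2 * enorm (u 0%N - v) ^+ 2))%:E)%E.
Proof.
move=> K K1 y v fy_fin gv_fin.
have [_ f_cvx f_proper] := f_ccp; have [_ _ [gNy g_dom]] := g_ccp.
have gs_cvx := fenchel_econvex gNy.
have gs_proper : proper_fun (fenchel g).
  by split=> [w|]; [exact: fenchel_gtNy|exists v].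
have a0 : 0 < alpha by rewrite alphaE divr_gt0.
have alpha_inv : alpha = L^-1 by rewrite alphaE mul1r.
have ai0 : 0 < alpha^-1 by rewrite invr_gt0.
have xsub k := prox_subgradient a0 f_cvx f_proper (x_step k).
have usub k := prox_subgradient ai0 gs_cvx gs_proper (u_step k).
pose fx k := fine (f (x k)); pose gu k := fine (fenchel g (u k)).
have fxE k : f (x k.+1) = (fx k.+1)%:E by rewrite fineK //; case: (xsub k).
have guE k : fenchel g (u k.+1) = (gu k.+1)%:E.
  by rewrite fineK //; case: (usub k).
have [fy fyE] : exists r, f y = r%:E.
  move: (f_proper.1 y) fy_fin; rewrite /edom /=.
  by case: (f y) => // r _ _; exists r.
have [gv gvE] : exists r, fenchel g v = r%:E.
  move: (gs_proper.1 v) gv_fin; rewrite /edom /=.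
  by case: (fenchel g v) => // r _ _; exists r.
pose gap k := fx k + h (x k) + dot v (x k) - gv
  - (fy + h y + dot (u k) y - gu k).
pose lam : R := 2 / (K%:R + 1).
have lam01 : 0 <= lam <= 1.
  have : 1 <= K%:R :> R by rewrite ler1n.
  move=> K_ge1; rewrite divr_ge0 ?ler_pdivrMr /=; lra.
pose D z := alpha *: (grad h z - grad h y).
pose S := x 0%N - y - D (x 0%N).
pose W k := x k - y - alpha *: (u k - v) - D (x k).
pose V k := 2^-1 * dot (W k - lam *: S) (W k - lam *: S).
pose c := 2^-1 * lam ^+ 2 * dot S S + lam * dot (D (x 0%N)) S.
have step k : alpha * gap k.+1 <= V k - V k.+1 + c.
  have [_ /(_ y fy fyE) If] := xsub k.
  have [_ /(_ v gv gvE) Ig] := usub k.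
  pose B := h y - h (x k.+1) - dot (grad h (x k.+1)) (y - x k.+1).
  have I1 : alpha * gap k.+1
      <= dot (W k - W k.+1) (W k.+1 + D (x k.+1)) - alpha * B.
    exact: primal_dual_gap_bound a0 If Ig.
  have I2 : 2^-1 * dot (D (x k.+1)) (D (x k.+1))
      + lam * dot (D (x k.+1) - D (x 0%N)) S <= alpha * B.
    exact: (bregman_lower_bound h_smooth L_gt0 (x 0%N) y (x k.+1)
      h_convex alpha_inv lam01).
  have I3 : dot (W k - W k.+1) (W k.+1 + D (x k.+1))
      - (2^-1 * dot (D (x k.+1)) (D (x k.+1))
         + lam * dot (D (x k.+1) - D (x 0%N)) S) <= V k - V k.+1 + c.
    exact: telescoping_bound.
  by apply: (le_trans I1); apply: le_trans I3; rewrite lerD2l lerN2.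
have sum_gap : alpha * \sum_(1 <= k < K.+1) gap k <= V 0%N + K%:R * c.
  have := sum_le_telescope step K.
  have : 0 <= V K by rewrite mulr_ge0 ?dot_ge0.
  by move: (V 0%N) (V K) (K%:R * c) (alpha * _) => v0 vK Kc G; lra.
have := initial_potential_bound S (D (x 0%N)) (alpha *: (u 0%N - v)) K1.
have W0E : W 0%N = S - alpha *: (u 0%N - v) by rewrite /W /S addrAC.
rewrite /= -/lam -/c -W0E -/(V 0%N) /S subrK dotZl dotZr mulrA -expr2.
rewrite -!enorm_sq; set B := _ + alpha ^+ 2 * _ => Bbound.
have Kgt0 : 0 < K%:R :> R by rewrite ltr0n.
have f_le k : (f (x k.+1) <= (fx k.+1)%:E)%E by rewrite fxE.
have g_le k : (fenchel g (u k.+1) <= (gu k.+1)%:E)%E by rewrite guE.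
have h_le k : ((h (x k.+1))%:E <= (h (x k.+1))%:E)%E by [].
have h_ecvx : econvex (fun z => (h z)%:E).
  move=> z w t /andP[t0 t1]; rewrite -!EFinM -EFinD lee_fin.
  by rewrite convex_function_le // ltW.
have := econvex_mean f_cvx f_le K1.
have := econvex_mean gs_cvx g_le K1.
have := econvex_mean (r := h \o x) h_ecvx h_le K1.
have := f_proper.1 (ergodic_mean x K).
have := gs_proper.1 (ergodic_mean u K).
rewrite /lagrangian fyE gvE lee_fin.
case: (f _) => [fb| |] //; case: (fenchel g _) => [gb| |] // _ _.
rewrite !lee_fin => hmean gmean fmean.
have gap_sumE m : \sum_(1 <= k < m.+1) gap k =
    \sum_(1 <= k < m.+1) fx k + \sum_(1 <= k < m.+1) h (x k)
    + dot v (\sum_(1 <= k < m.+1) x k) - m%:R * gv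
    - (m%:R * (fy + h y) + dot (\sum_(1 <= k < m.+1) u k) y
       - \sum_(1 <= k < m.+1) gu k).
  rewrite dot_sumr (dotC _ y) dot_sumr.
  elim: m => [|m IH]; first by rewrite !big_geq //; ring.
  rewrite !(@big_nat_recr _ _ _ m.+1) //= IH -natr1 /gap (dotC _ y); ring.
have mean_gap : fb + h (ergodic_mean x K) + dot v (ergodic_mean x K) - gv
    - (fy + h y + dot (ergodic_mean u K) y - gb)
    <= K%:R^-1 * \sum_(1 <= k < K.+1) gap k.
  rewrite gap_sumE [in dot v _]/ergodic_mean [in dot _ y]/ergodic_mean dotZl dotZr.
  have Kn0 : K%:R != 0 :> R by rewrite gt_eqF.
  apply: le_of_slack (addr_ge0 (addr_ge0 (_ : 0 <= _ - fb) (_ : 0 <= _ - gb))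
    (_ : 0 <= _ - h (ergodic_mean x K))) _.
  - by rewrite subr_ge0; exact: fmean.
  - by rewrite subr_ge0; exact: gmean.
  - by rewrite subr_ge0; exact: hmean.
  - by rewrite /=; field.
apply: (le_trans mean_gap).
rewrite -(ler_pM2l (mulr_gt0 a0 Kgt0)).
have -> : alpha * K%:R * (K%:R^-1 * \sum_(1 <= k < K.+1) gap k)
    = alpha * \sum_(1 <= k < K.+1) gap k.
  by rewrite -mulrA mulVKf // gt_eqF.
apply: (le_trans (le_trans sum_gap Bbound)).
apply: (le_of_slack (lexx 0)).
by field; rewrite !gt_eqF //; lra.
Qed.
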